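(* Let $Q\in\mathbb{R}^{n_x\times n_x}$ be symmetric positive definite, $r>0$, $q,c,b\in\mathbb{R}^{n_x}$ and $A\in\mathbb{R}^{n_x\times n_x}$ with $(A,b)$ controllable. For $M<N$ in $\mathbb{Z}_{>0}$ and $x_M^*,\lambda_N^*\in\mathbb{R}^{n_x}$ let $\mathcal{P}_{M:N}(x_M^*,\lambda_N^* )$ be the linear quadratic optimal control problem (with scalar input and no inequality constraints) defined in the context. Then the asymptotic decay of sensitivity property holds with $X=\Lambda=\mathbb{R}^{n_x}$: there exists a sequence $\{\varepsilon_i\}_{i\in\mathbb{Z}_{\ge0}}$ with $\varepsilon_i\to0$ as $i\to\infty$, not depending on $M$, $N$ or the boundary data, such that for all $M<N$ in $\mathbb{Z}_{>0}$ and all $(x_M^*,\lambda_N^* ),(\tilde x_M,\tilde\lambda_N)\in\mathbb{R}^{n_x}\times\mathbb{R}^{n_x}$, the primal-dual solutions $z^*_{M:N}$ of $\mathcal{P}_{M:N}(x_M^*,\lambda_N^* )$ and $\tilde z_{M:N}$ of $\mathcal{P}_{M:N}(\tilde x_M,\tilde\lambda_N)$ satisfy $$\Vert z_i^*-\tilde z_i\Vert_\infty\le\varepsilon_{i-M}\Vert x_M^*-\tilde x_M\Vert_\infty+\varepsilon_{N-i}\Vert\lambda_N^*-\tilde\lambda_N\Vert_\infty\qquad\text{for all integers } i \text{ with } M\le i\le N.$$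
   Context: $(A,b)$ is controllable if $[\,b\ \ Ab\ \cdots\ A^{n_x-1}b\,]$ has full row rank. $\Vert\cdot\Vert_\infty$ is the max norm of a vector. **The problem.** $\mathcal{P}_{M:N}(x_M^*,\lambda_N^* )$ is $$\min_{x_M,\dots,x_N\in\mathbb{R}^{n_x},\ u_M,\dots,u_{N-1}\in\mathbb{R}}\ \sum_{i=M}^{N-1}\left(x_i^\top Qx_i-q^\top x_i+r u_i^2\right)+(\lambda_N^* )^\top x_N$$ subject to $x_M=x_M^*$ (dual variable $\lambda_M\in\mathbb{R}^{n_x}$) and $x_i=Ax_{i-1}+bu_{i-1}+c$ for $M+1\le i\le N$ (dual variable $\lambda_i\in\mathbb{R}^{n_x}$). **Primal-dual solution.** It is the tuple satisfying the KKT conditions: $x_M=x_M^*$, $\lambda_N=\lambda_N^*$, and for $M\le i\le N-1$: $x_{i+1}=Ax_i+bu_i+c$, $\ \lambda_i=A^\top\lambda_{i+1}+2Qx_i-q$, $\ 0=b^\top\lambda_{i+1}+2ru_i$. Under the stated hypotheses it exists and is unique for all boundary data in $\mathbb{R}^{n_x}\times\mathbb{R}^{n_x}$. We write $z_i:=(x_i,\lambda_i)$ and suppress the controls in the notation. *)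

(* Defs.v *)
From HB Require Import structures.
From mathcomp Require Import all_boot all_order all_algebra.
From mathcomp Require Import all_classical all_reals all_analysis.

Set Implicit Arguments.
Unset Strict Implicit.
Unset Printing Implicit Defensive.

Import Order.TTheory GRing.Theory Num.Theory.
Import numFieldNormedType.Exports.

Local Open Scope classical_set_scope.
Local Open Scope ring_scope.

Definition posdefmx (R : realType) (n : nat) (Q : 'M[R]_n) : Prop :=
  Q^T = Q /\
  forall x : 'cV[R]_n, x != 0 -> 0 < (x^T *m Q *m x) ord0 ord0.

(* The matrix [b  A b  ...  A^(n-1) b]. *)
Definition controllability_mx (R : realType) (n : nat)
    (A : 'M[R]_n) (b : 'cV[R]_n) : 'M[R]_n :=
  \matrix_(i < n, j < n) (A ^+ j *m b) i ord0.

(* In MathComp, full row rank (linearly independent rows) is [row_free]. *)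
Definition controllable (R : realType) (n : nat)
    (A : 'M[R]_n) (b : 'cV[R]_n) : Prop :=
  row_free (controllability_mx A b).

(* KKT system of the linear quadratic problem P_{M:N}(xM, lN)
     min  \sum_(M <= i < N) (x_i^T Q x_i - q^T x_i + r u_i^2) + lN^T x_N
     s.t. x_M = xM                               (multiplier lam_M),
          x_i = A x_(i-1) + b u_(i-1) + c        (multiplier lam_i), M < i <= N,
   where each constraint "lhs = rhs" enters the Lagrangian as
   lam^T (rhs - lhs).  Trajectories are indexed by all of nat, but only
   x_i, lam_i with M <= i <= N and u_i with M <= i < N are meaningful; the
   other values are unconstrained. *)
Definition primal_dual_solution (R : realType) (n : nat)
    (A : 'M[R]_n) (b c : 'cV[R]_n) (Q : 'M[R]_n) (q : 'cV[R]_n) (r : R)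
    (M N : nat) (xM lN : 'cV[R]_n)
    (x : nat -> 'cV[R]_n) (u : nat -> R) (lam : nat -> 'cV[R]_n) : Prop :=
  [/\ x M = xM,
      lam N = lN &
      forall i : nat, (M <= i < N)%N ->
        [/\ x i.+1 = A *m x i + u i *: b + c,
            lam i = A^T *m lam i.+1 + 2%:R *: (Q *m x i) - q &
            0 = (b^T *m lam i.+1) ord0 ord0 + 2%:R * r * u i]].

(* z_i = (x_i, lam_i) is [col_mx (x i) (lam i)], and `|_| is the max norm,
   which is the norm of MathComp-Analysis on matrices. *)
Definition asymptotic_decay_of_sensitivity (R : realType) (n : nat)
    (A : 'M[R]_n) (b c : 'cV[R]_n) (Q : 'M[R]_n) (q : 'cV[R]_n) (r : R)
    (X L : set 'cV[R]_n) : Prop :=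
  exists eps : nat -> R,
    (eps i @[i --> \oo] --> (0 : R)) /\
    forall (M N : nat), (0 < M)%N -> (M < N)%N ->
    forall (xM lN xM' lN' : 'cV[R]_n), X xM -> L lN -> X xM' -> L lN' ->
    forall (x : nat -> 'cV[R]_n) (u : nat -> R) (lam : nat -> 'cV[R]_n)
           (x' : nat -> 'cV[R]_n) (u' : nat -> R) (lam' : nat -> 'cV[R]_n),
      primal_dual_solution A b c Q q r M N xM lN x u lam ->
      primal_dual_solution A b c Q q r M N xM' lN' x' u' lam' ->
    forall i : nat, (M <= i <= N)%N ->
      `| col_mx (x i) (lam i) - col_mx (x' i) (lam' i) |
        <= eps (i - M)%N * `| xM - xM' | + eps (N - i)%N * `| lN - lN' |.

(* Main.v *)
Require Import Defs.
From HB Require Import structures.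
From mathcomp Require Import all_boot all_order all_algebra.
From mathcomp Require Import all_classical all_reals all_analysis.
From mathcomp Require Import zify ring lra.

Set Implicit Arguments.
Unset Strict Implicit.
Unset Printing Implicit Defensive.

Import Order.TTheory GRing.Theory Num.Theory.
Import numFieldNormedType.Exports.

Local Open Scope classical_set_scope.
Local Open Scope ring_scope.

(** The difference of two primal-dual solutions solves the same KKT system with
    c = 0 and q = 0, so it is enough to bound one homogeneous solution (x, lam)
    by its boundary data x_M and lam_N.

    The argument rests on the pairing V_i = lam_i^T x_i.  The KKT equations give
    V_i - V_(i+1) = 2 (x_i^T Q x_i + r u_i^2) ([pairing_step]), so V decreases,
    and its total decrease over an interval controls all the states and inputs
    in it ([stage_bound]).  Controllability of (A, b) is observability of the
    adjoint equation lam_i = A^T lam_(i+1) + 2 Q x_i through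
    b^T lam_(i+1) = - 2 r u_i: over n consecutive stages the inputs and states
    determine the costate ([terminal_costate_bound]).  Together, with
    z_i = (x_i, lam_i),

      |z_j|^2 <= K (V_i - V_(i+n))   for i <= j <= i + n   ([window_bound]).

    Since |V_j| <= n |z_j|^2, V itself obeys |V_j| <= L (V_i - V_(i+n)).  For
    j = i + n this makes the positive part of V contract by L / (1 + L) over
    every n stages forward in time, and for j = i it makes the negative part
    contract likewise backward in time.  Hence, with
    eta k = sg ^ (k / n - 1) and sg = L / (1 + L),

      |z_i|^2 <= K (eta (i - M) V_M^+ + eta (N - i) V_N^-)
                                                ([long_horizon_bound]).

    It remains to bound V_M^+ <= n |x_M| |lam_M| and V_N^- <= n |x_N| |lam_N| by
    the data.  The crude bound of |lam_M| and |x_N| by |x_M| + |lam_N| does not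
    suffice: it leaves the term eta (i - M) |x_M| |lam_N|, which near i = M stays
    large however far away N is.  But the last display at i = M and at i = N is a pair
    of inequalities coupled only through the small factor eta (N - M), and
    completing squares in it yields V_M^+ <= C (|x_M|^2 + eta (N - M) |lam_N|^2)
    and symmetrically for V_N^- ([boundary_products],
    [boundary_superposition]).  Horizons shorter than n, where nothing has to
    decay, are covered by a uniform bound ([short_horizon_bound]). *)

(** * Matrices and the max norm *)

Section EntryRules.
Variables (R : pzRingType) (m p : nat).
Implicit Types B C : 'M[R]_(m, p).

Let entryD B C i j : (B + C) i j = B i j + C i j. Proof. by rewrite mxE. Qed.
Let entryN B i j : (- B) i j = - B i j. Proof. by rewrite mxE. Qed.
Let entryZ (a : R) B i j : (a *: B) i j = a * B i j. Proof. by rewrite mxE. Qed.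

Definition entryE := (entryD, entryN, entryZ).

End EntryRules.

Section MaxNorm.
Variable R : realType.

Lemma norm_entry m p (B : 'M[R]_(m, p)) i j : `|B i j| <= `|B|.
Proof.
rewrite [leRHS]/Num.Def.normr /= mx_normrE; apply/bigmax_geP; right => /=.
by exists (i, j).
Qed.

Lemma norm_mx_le m p (B : 'M[R]_(m, p)) (e : R) : 0 <= e ->
  (forall i j, `|B i j| <= e) -> `|B| <= e.
Proof.
by move=> e0 Be; rewrite /Num.Def.normr/= mx_normrE (bigmax_le _ e0).
Qed.

Lemma norm_trmx m p (B : 'M[R]_(m, p)) : `|B^T| = `|B|.
Proof.
apply/eqP; rewrite eq_le; apply/andP; split; apply: norm_mx_le => // i j.
  by rewrite mxE norm_entry.
by rewrite -[B]trmxK mxE trmxK norm_entry.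
Qed.

Lemma norm_mulmx m p k (B : 'M[R]_(m, p)) (C : 'M[R]_(p, k)) :
  `|B *m C| <= p%:R * `|B| * `|C|.
Proof.
apply: norm_mx_le => [|i j]; first by rewrite !mulr_ge0.
rewrite mxE (le_trans (ler_norm_sum _ _ _))//.
have -> : p%:R * `|B| * `|C| = \sum_(l < p) `|B| * `|C|.
  by rewrite sumr_const card_ord -[RHS]mulr_natl mulrA.
by apply: ler_sum => l _; rewrite normrM ler_pM ?norm_entry.
Qed.

Lemma norm_col_mx m p k (B : 'M[R]_(m, k)) (C : 'M[R]_(p, k)) :
  `|col_mx B C| = Num.max `|B| `|C|.
Proof.
apply/eqP; rewrite eq_le ge_max; apply/and3P; split.
- apply: norm_mx_le => [|i j]; first by rewrite le_max normr_ge0.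
  by rewrite mxE; case: fintype.splitP => l _; rewrite le_max norm_entry ?orbT.
- by apply: norm_mx_le => // i j; rewrite -(col_mxEu B C) norm_entry.
- by apply: norm_mx_le => // i j; rewrite -(col_mxEd B C) norm_entry.
Qed.

End MaxNorm.

(** * Coercivity of a positive definite form *)

Section Coercivity.
Variables (R : realType) (n : nat) (Q : 'M[R]_n).
Hypothesis hQ : posdefmx Q.

Lemma posdefmx_ge0 (x : 'cV[R]_n) : 0 <= (x^T *m Q *m x) ord0 ord0.
Proof.
have [->|x0] := eqVneq x 0; first by rewrite mulmx0 mxE.
exact/ltW/hQ.2.
Qed.

Lemma posdefmx_cauchy_schwarz (x y : 'cV[R]_n) :
  ((y^T *m Q *m x) ord0 ord0) ^+ 2 <=
  (y^T *m Q *m y) ord0 ord0 * (x^T *m Q *m x) ord0 ord0.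
Proof.
have [->|y0] := eqVneq y 0.
  by rewrite trmx0 !mul0mx !mxE expr0n/= mul0r.
have := hQ.2 _ y0.
set al := (y^T *m Q *m y) ord0 ord0; set be := (y^T *m Q *m x) ord0 ord0.
set ga := (x^T *m Q *m x) ord0 ord0 => al0.
have be' : (x^T *m Q *m y) ord0 ord0 = be.
  by rewrite /be -[in RHS](trmxK (_ *m x)) [RHS]mxE !trmx_mul trmxK hQ.1 mulmxA.
(* Up to the factor al, this vector is the part of x that is Q-orthogonal to y. *)
have := posdefmx_ge0 (al *: x - be *: y).
rewrite [(_ - _)^T]linearB /= ![(_ *: _)^T]linearZ /= !(mulmxBl, mulmxBr).
rewrite -!(scalemxAl, scalemxAr).
rewrite !entryE -/al -/ga -/be be' => h.
rewrite -(ler_pM2l al0); lra.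
Qed.

Lemma posdefmx_unit : Q \in unitmx.
Proof.
rewrite -row_free_unit; apply: inj_row_free => v vQ0.
apply/eqP; rewrite -trmx_eq0; apply/negPn/negP => /hQ.2.
by rewrite trmxK vQ0 mul0mx mxE ltxx.
Qed.

(** Each coordinate x_i is the Q-inner product of x with Q^-1 e_i, so
    Cauchy-Schwarz bounds it by the form. *)
Lemma posdefmx_coercive : exists2 K : R, 0 <= K &
  forall x : 'cV[R]_n, `|x| ^+ 2 <= K * (x^T *m Q *m x) ord0 ord0.
Proof.
pose y i : 'cV[R]_n := (row i (invmx Q))^T.
exists (\sum_i ((y i)^T *m Q *m y i) ord0 ord0).
  by apply: sumr_ge0 => i _; apply: posdefmx_ge0.
move=> x; rewrite -[leRHS]sqr_sqrtr; last first.
  by rewrite mulr_ge0 ?posdefmx_ge0// sumr_ge0// => i _; apply: posdefmx_ge0.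
rewrite ler_sqr ?nnegrE ?sqrtr_ge0//; apply: norm_mx_le => [|i j].
  exact: sqrtr_ge0.
rewrite -sqrtr_sqr ler_wsqrtr//.
have -> : x i j = ((y i)^T *m Q *m x) ord0 ord0.
  rewrite trmxK -row_mul mulVmx ?posdefmx_unit// -row_mul mul1mx mxE.
  by rewrite (ord1 j).
apply: (le_trans (posdefmx_cauchy_schwarz _ _)).
rewrite ler_wpM2r ?posdefmx_ge0// (bigD1 i)//= lerDl.
by apply: sumr_ge0 => k _; apply: posdefmx_ge0.
Qed.

End Coercivity.

(** * Geometric decay in steps of n *)

(** The exponent is k / n - 1 and not k / n because the value is read n stages
    early, at k - n: the estimate of stage k uses a window of n stages around it.
    Truncated subtraction makes the bound at k < n the trivial one. *)
Lemma geometric_decay (R : realType) (n : nat) (f : nat -> R) (sg : R) (T : nat) :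
  (0 < n)%N -> 0 <= sg ->
  (forall j k, (j <= k <= T)%N -> f k <= f j) ->
  (forall k, (k + n <= T)%N -> f (k + n)%N <= sg * f k) ->
  forall k, (k <= T)%N -> f (k - n)%N <= sg ^+ (k %/ n).-1 * f 0%N.
Proof.
move=> n0 sg0 fanti fcontr.
have fmul m : (m * n <= T)%N -> f (m * n)%N <= sg ^+ m * f 0%N.
  elim: m => [|m IH] mT; first by rewrite mul0n expr0 mul1r.
  have -> : (m.+1 * n = m * n + n)%N by lia.
  apply: (le_trans (fcontr _ _)); first by lia.
  by rewrite exprS -mulrA ler_wpM2l// IH//; lia.
move=> k kT; have [kn|nk] := ltnP k n.
  by rewrite divn_small//= (_ : (k - n)%N = 0%N) ?expr0 ?mul1r//; lia.
have q0 : (0 < k %/ n)%N by rewrite divn_gt0.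
have := leq_divM k n; case: (k %/ n)%N q0 => // m _ mk /=.
by apply: le_trans (fmul m _); [apply: fanti|]; lia.
Qed.

Lemma decay_profile_cvg0 (R : realType) (n : nat) (K sg : R) : (0 < n)%N ->
  0 <= sg < 1 ->
  Num.sqrt (K * sg ^+ (k %/ n).-1) @[k --> \oo] --> (0 : R).
Proof.
move=> n0 /andP[sg0 sg1].
rewrite -[0 in X in _ --> X](@sqrtr0 R).
apply: continuous_cvg; first exact: sqrt_continuous.
rewrite -[0 in X in _ --> X](mulr0 K).
apply: cvgMl_tmp.
have h : (sg ^+ m) @[m --> \oo] --> (0 : R) by apply: cvg_expr; rewrite ger0_norm.
apply: (cvg_comp (fun k => (k %/ n).-1) (fun m => sg ^+ m) _ h).
(* The exponent reaches m as soon as k >= (m + 1) n. *)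
move=> P [m _ mP]; exists (m.+1 * n)%N => // k /= mk; apply: mP => /=.
have := leq_div2r n mk; rewrite mulnK//; lia.
Qed.

(** * Homogeneous solutions and the decrease of the pairing *)

Section Trajectories.
Variables (R : realType) (n : nat) (A : 'M[R]_n) (b : 'cV[R]_n)
  (Q : 'M[R]_n) (r : R).
Implicit Types (x lam : nat -> 'cV[R]_n) (u : nat -> R).

(** The boundary data are read off the trajectory, so that a solution on an
    interval is also one on every subinterval. *)
Definition homogeneous_solution M N x u lam :=
  primal_dual_solution A b 0 Q 0 r M N (x M) (lam N) x u lam.

Definition pairing x lam i : R := ((lam i)^T *m x i) ord0 ord0.

Lemma norm_pairing x lam i :
  `|pairing x lam i| <= n%:R * `|lam i| * `|x i|.
Proof.
apply: le_trans (norm_entry _ _ _) _.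
by rewrite -(norm_trmx (lam i)) norm_mulmx.
Qed.

Lemma solution_difference (c q : 'cV[R]_n) M N xM lN xM' lN' x u lam x' u' lam' :
  primal_dual_solution A b c Q q r M N xM lN x u lam ->
  primal_dual_solution A b c Q q r M N xM' lN' x' u' lam' ->
  homogeneous_solution M N (fun i => x i - x' i) (fun i => u i - u' i)
    (fun i => lam i - lam' i).
Proof.
move=> [_ _ h] [_ _ h']; split=> // i iMN.
have [hx hl hu] := h i iMN; have [hx' hl' hu'] := h' i iMN.
split.
- by rewrite hx hx' addr0 mulmxBr scalerBl !opprD addrACA subrr addr0 addrACA.
- rewrite {1}hl {1}hl' subr0 !mulmxBr scalerBr !opprD opprK.
  by rewrite addrACA [- q + q]addrC subrr addr0 addrACA.
- rewrite mulmxBr !entryE.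
  by rewrite mulrBr addrACA -opprD -hu -hu' subr0.
Qed.

Lemma homogeneous_solution_sub M N M' N' x u lam :
  (M <= M')%N -> (N' <= N)%N ->
  homogeneous_solution M N x u lam -> homogeneous_solution M' N' x u lam.
Proof. by move=> MM NN [_ _ h]; split=> // i ?; apply: h; lia. Qed.

(** The coupling terms lam_(i+1)^T A x_i of the primal and the adjoint equation
    cancel, and stationarity turns u_i lam_(i+1)^T b into - 2 r u_i^2. *)
Lemma pairing_step M N x u lam i : Q^T = Q ->
  homogeneous_solution M N x u lam -> (M <= i < N)%N ->
  pairing x lam i - pairing x lam i.+1 =
  2 * (((x i)^T *m Q *m x i) ord0 ord0 + r * u i ^+ 2).
Proof.
move=> QT [_ _ h] /h[hx hl hu]; rewrite /pairing {1}hl hx subr0 addr0.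
rewrite [(_ + _)^T]linearD /= [(2%:R *: _)^T]linearZ /= !trmx_mul trmxK QT.
rewrite mulmxDl mulmxDr -scalemxAl -scalemxAr mulmxA.
rewrite !entryE.
have -> : ((lam i.+1)^T *m b) ord0 ord0 = (b^T *m lam i.+1) ord0 ord0.
  by rewrite -[in LHS](trmxK (_ *m b)) [LHS]mxE trmx_mul trmxK.
rewrite (_ : (b^T *m lam i.+1) ord0 ord0 = - (2%:R * r * u i)).
  by ring.
by apply/eqP; rewrite -addr_eq0 -hu.
Qed.

Hypotheses (hQ : posdefmx Q) (hr : 0 < r).

Lemma pairing_anti M N x u lam j k : homogeneous_solution M N x u lam ->
  (M <= j <= k)%N -> (k <= N)%N -> pairing x lam k <= pairing x lam j.
Proof.
move=> h /andP[Mj jk]; elim: k jk => [|k IH] jk kN.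
  by rewrite (_ : j = 0%N) //; lia.
have [->//|jk'] := eqVneq j k.+1.
apply: le_trans (IH _ _); [|lia|lia].
rewrite -subr_ge0 (pairing_step hQ.1 h); last by lia.
by rewrite mulr_ge0// addr_ge0 ?posdefmx_ge0// mulr_ge0 ?sqr_ge0// ltW.
Qed.

(** The decrease of V over [M, N] bounds each single stage cost in it.  The bound
    is stated with any s such that s^2 dominates the decrease, so that later
    estimates are linear in s. *)
Lemma stage_bound : exists2 K : R, 0 <= K &
  forall M N x u lam s, homogeneous_solution M N x u lam ->
    0 <= s -> pairing x lam M - pairing x lam N <= s ^+ 2 ->
    forall j, (M <= j < N)%N -> `|x j| <= K * s /\ `|u j| <= K * s.
Proof.
have [K K0 hK] := posdefmx_coercive hQ.
exists (Num.sqrt K + Num.sqrt r^-1); first by rewrite addr_ge0 ?sqrtr_ge0.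
move=> M N x u lam s h s0 hs j jMN.
have := pairing_step hQ.1 h jMN.
have h1 : pairing x lam j <= pairing x lam M by apply: (pairing_anti h); lia.
have h2 : pairing x lam N <= pairing x lam j.+1 by apply: (pairing_anti h); lia.
move=> E.
have q0 := posdefmx_ge0 hQ (x j).
have u0 : 0 <= r * u j ^+ 2 by rewrite mulr_ge0 ?sqr_ge0// ltW.
have hq : ((x j)^T *m Q *m x j) ord0 ord0 <= s ^+ 2 by lra.
have hu : r * u j ^+ 2 <= s ^+ 2 by lra.
have sqrtM t : 0 <= t -> Num.sqrt t * s = Num.sqrt (t * s ^+ 2).
  by move=> t0; rewrite sqrtrM// sqrtr_sqr ger0_norm.
split.
  rewrite (@le_trans _ _ (Num.sqrt K * s))//; last first.
    by rewrite ler_wpM2r// lerDl sqrtr_ge0.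
  rewrite sqrtM// -(ger0_norm (normr_ge0 (x j))) -sqrtr_sqr ler_wsqrtr//.
  by rewrite (le_trans (hK _))// ler_wpM2l.
have r0 : 0 <= r^-1 by rewrite invr_ge0 ltW.
rewrite (@le_trans _ _ (Num.sqrt r^-1 * s))//; last first.
  by rewrite ler_wpM2r// lerDr sqrtr_ge0.
by rewrite sqrtM// -sqrtr_sqr ler_wsqrtr// ler_pdivlMl.
Qed.

(** * Reconstruction of states and costates from the decrease of the pairing *)

(** The adjoint recursion, run backward from lam_N over at most n stages, has the
    small states 2 Q x_j as sources; x_N follows from the last stage. *)
Lemma backward_bound : exists2 K : R, 0 <= K &
  forall M N x u lam s, homogeneous_solution M N x u lam ->
    (M < N <= M + n)%N ->
    0 <= s -> pairing x lam M - pairing x lam N <= s ^+ 2 ->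
    forall j, (M <= j <= N)%N ->
      `|col_mx (x j) (lam j)| <= K * (`|lam N| + s).
Proof.
have [K K0 hK] := stage_bound.
pose k := 1 + n%:R * `|A| + 2 * (n%:R * `|Q|) * K.
pose kx := n%:R * `|A| * K + K * `|b| + K.
have k1 : 1 <= k by rewrite /k -addrA lerDl addr_ge0 ?mulr_ge0.
have kx0 : 0 <= kx by rewrite !addr_ge0 ?mulr_ge0.
exists (kx + k ^+ n); first by rewrite addr_ge0// exprn_ge0// (le_trans ler01).
move=> M N x u lam s h MN s0 hs j jMN.
have l0 : 0 <= `|lam N| by [].
have stage := hK _ _ _ _ _ _ h s0 hs.
have [_ _ hh] := h.
rewrite norm_col_mx ge_max; apply/andP; split.
  apply: (@le_trans _ _ (kx * s)); last first.
    rewrite ler_pM ?lerDl ?lerDr// exprn_ge0// (le_trans ler01)//.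
  have [jN|jN] := ltnP j N.
    rewrite (le_trans (stage j _).1) ?ler_wpM2r//; first by lia.
    by rewrite /kx lerDr addr_ge0 ?mulr_ge0.
  have -> : j = N.-1.+1 by lia.
  have [-> _ _] := hh N.-1 ltac:(lia).
  have [sx su] := stage N.-1 ltac:(lia).
  rewrite addr0 (le_trans (ler_normD _ _))//.
  apply: (@le_trans _ _ (n%:R * `|A| * (K * s) + K * s * `|b|)); last first.
    by rewrite /kx; have := mulr_ge0 K0 s0; lra.
  rewrite lerD//; last by rewrite normrZ ler_wpM2r.
  by rewrite (le_trans (norm_mulmx _ _))// ler_wpM2l ?mulr_ge0.
(* Adding s to the norm turns the affine recursion into a geometric one. *)
have back m : (m <= N - M)%N -> `|lam (N - m)%N| + s <= k ^+ m * (`|lam N| + s).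
  elim: m => [|m IH] mN; first by rewrite subn0 expr0 mul1r.
  rewrite exprS -mulrA.
  apply: le_trans (ler_wpM2l (le_trans ler01 k1) (IH _)); last by lia.
  have [_ hl _] := hh (N - m.+1)%N ltac:(lia).
  have [sx _] := stage (N - m.+1)%N ltac:(lia).
  rewrite hl subr0 (_ : (N - m.+1).+1 = (N - m)%N); last by lia.
  set l := lam (N - m)%N; set y := x _.
  have lA : `|A^T *m l| <= n%:R * `|A| * `|l| by rewrite -(norm_trmx A) norm_mulmx.
  have lQ : `|2%:R *: (Q *m y)| <= 2 * (n%:R * `|Q|) * (K * s).
    rewrite normrZ ger0_norm// -mulrA ler_wpM2l//.
    by rewrite (le_trans (norm_mulmx _ _))// ler_wpM2l ?mulr_ge0.
  have tri := ler_normD (A^T *m l) (2%:R *: (Q *m y)).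
  have e1 : 0 <= n%:R * `|A| * s by rewrite !mulr_ge0.
  have e2 : 0 <= 2 * (n%:R * `|Q|) * K * `|l| by rewrite !mulr_ge0.
  have e3 : 0 <= `|l| by [].
  rewrite /k; lra.
have := back (N - j)%N ltac:(lia); rewrite subKn; last by lia.
move=> hj; apply: (@le_trans _ _ (k ^+ n * (`|lam N| + s))); last first.
  by rewrite ler_wpM2r ?lerDr// addr_ge0.
apply: (le_trans _ (le_trans hj _)); first by rewrite lerDl.
by rewrite ler_wpM2r ?addr_ge0// ler_weXn2l//; lia.
Qed.

(** The decrease s^2 = V_M - V_N is at most n (|x_M| |lam_M| + |lam_N| |x_N|), and
    [backward_bound] makes this at most n K (|x_M| + |lam_N|) (|lam_N| + s).  This
    quadratic inequality bounds s by the data. *)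
Lemma short_horizon_bound : exists2 K : R, 0 <= K &
  forall M N x u lam, homogeneous_solution M N x u lam ->
    (M < N <= M + n)%N -> forall j, (M <= j <= N)%N ->
    `|col_mx (x j) (lam j)| ^+ 2 <= K * (`|x M| ^+ 2 + `|lam N| ^+ 2).
Proof.
have [K K0 hK] := backward_bound.
exists (4 * K ^+ 2 * (1 + 2 * (n%:R * K) ^+ 2 + 2 * (n%:R * K))).
  by rewrite !mulr_ge0 ?sqr_ge0// !addr_ge0 ?mulr_ge0 ?sqr_ge0.
move=> M N x u lam h MN j jMN.
pose s := Num.sqrt (pairing x lam M - pairing x lam N).
have s0 : 0 <= s := sqrtr_ge0 _.
have s2 : s ^+ 2 = pairing x lam M - pairing x lam N.
  by rewrite sqr_sqrtr// subr_ge0 (pairing_anti h)//; lia.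
have hz i : (M <= i <= N)%N -> `|col_mx (x i) (lam i)| <= K * (`|lam N| + s).
  by apply: (hK _ _ _ _ _ s h MN s0); rewrite s2.
have zM := hz M ltac:(lia); have zN := hz N ltac:(lia).
rewrite !norm_col_mx !ge_max in zM zN; move: zM zN => /andP[_ lM] /andP[xN _].
have := hz j jMN; set z := `|col_mx _ _| => zj.
have z0 : 0 <= z := normr_ge0 _.
have vM := norm_pairing x lam M; have vN := norm_pairing x lam N.
move: vM vN lM xN zj.
set a := `|x M|; set d := `|lam N|; set L := `|lam M|; set Y := `|x N|.
move=> /ler_normlP[_ vM] /ler_normlP[vN _] lM xN zj.
have a0 : 0 <= a := normr_ge0 _.
have d0 : 0 <= d := normr_ge0 _.
pose T := n%:R * K.
have T0 : 0 <= T by rewrite mulr_ge0.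
have hs : s ^+ 2 <= T * ((a + d) * (d + s)).
  rewrite s2 /T -mulrA.
  have h1 : n%:R * L * a <= n%:R * (K * (d + s)) * a by rewrite ler_wpM2r ?ler_wpM2l.
  have h2 : n%:R * d * Y <= n%:R * d * (K * (d + s)) by rewrite ler_wpM2l ?mulr_ge0.
  lra.
have z2 : z ^+ 2 <= K ^+ 2 * (d + s) ^+ 2.
  by rewrite -exprMn ler_sqr ?nnegrE// mulr_ge0// addr_ge0.
apply: (le_trans z2).
rewrite [4 * _]mulrC -2![leRHS]mulrA ler_wpM2l ?sqr_ge0//.
(* From hs and e1, s^2 <= 2 T (a + d) d + T^2 (a + d)^2. *)
have e1 := sqr_ge0 (s - T * (a + d)).
have e2 := sqr_ge0 (s - d).
have e3 : 0 <= T * (a - d) ^+ 2 by rewrite mulr_ge0 ?sqr_ge0.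
have e4 : 0 <= T ^+ 2 * (a - d) ^+ 2 by rewrite mulr_ge0 ?sqr_ge0.
have e5 : 0 <= T * a ^+ 2 by rewrite mulr_ge0 ?sqr_ge0.
have e6 : 0 <= T * d ^+ 2 by rewrite mulr_ge0 ?sqr_ge0.
have e7 : 0 <= T ^+ 2 * d ^+ 2 by rewrite mulr_ge0 ?sqr_ge0.
have e8 : 0 <= T ^+ 2 * a ^+ 2 by rewrite mulr_ge0 ?sqr_ge0.
have e9 : 0 <= a ^+ 2 := sqr_ge0 a.
have e10 : 0 <= d ^+ 2 := sqr_ge0 d.
rewrite -/T.
lra.
Qed.

(** The costate lam_m is observed through the vectors A^k b, going back one more
    stage with each k: stationarity is the case k = 0, and
    b^T (A^T)^(k+1) lam_m = b^T (A^T)^k (lam_(m-1) - 2 Q x_(m-1)). *)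
Lemma observed_costate k : exists2 K : R, 0 <= K &
  forall M N x u lam s, homogeneous_solution M N x u lam ->
    0 <= s -> pairing x lam M - pairing x lam N <= s ^+ 2 ->
    forall m, (M + k < m <= N)%N ->
      `|((A ^+ k *m b)^T *m lam m) ord0 ord0| <= K * s.
Proof.
have [K K0 hK] := stage_bound.
elim: k => [|k [Kk Kk0 hKk]].
  exists (2 * r * K); first by rewrite !mulr_ge0// ltW.
  move=> M N x u lam s h s0 hs m; rewrite addn0 => mMN.
  have [_ su] := hK _ _ _ _ _ _ h s0 hs m.-1 ltac:(lia).
  have [_ _ /(_ m.-1 ltac:(lia))[_ _]] := h.
  rewrite prednK; last by lia.
  move=> /esym/eqP; rewrite addr_eq0 expr0 mul1mx => /eqP ->.
  rewrite normrN !normrM (ger0_norm (ltW hr)) ger0_norm// -[leRHS]mulrA.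
  by rewrite ler_wpM2l// mulr_ge0// ltW.
pose v := 2 *: ((A ^+ k *m b)^T *m Q).
exists (Kk + n%:R * `|v| * K); first by rewrite addr_ge0 ?mulr_ge0.
move=> M N x u lam s h s0 hs m mMN.
have hm := hKk _ _ _ _ _ _ h s0 hs m.-1 ltac:(lia).
have [sx _] := hK _ _ _ _ _ _ h s0 hs m.-1 ltac:(lia).
have [_ _ /(_ m.-1 ltac:(lia))[_ hl _]] := h.
move: hl; rewrite subr0 prednK; last by lia.
move=> hl.
have -> : (A ^+ k.+1 *m b)^T *m lam m =
    (A ^+ k *m b)^T *m lam m.-1 - v *m x m.-1.
  rewrite exprS -mulmxA [in LHS]trmx_mul hl mulmxDr mulmxA -scalemxAr.
  by rewrite -scalemxAl mulmxA addrK.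
rewrite !entryE (le_trans (ler_normB _ _))//.
rewrite mulrDl lerD// (le_trans (norm_entry _ _ _))//.
by rewrite (le_trans (norm_mulmx _ _))// -[leRHS]mulrA ler_wpM2l ?mulr_ge0.
Qed.

Hypotheses (hn : (0 < n)%N) (hAb : controllable A b).

(** The numbers (A^k b)^T lam, k < n, are the entries of C^T lam, where C is the
    controllability matrix, which is invertible. *)
Lemma terminal_costate_bound : exists2 K : R, 0 <= K &
  forall M x u lam s, homogeneous_solution M (M + n)%N x u lam ->
    0 <= s -> pairing x lam M - pairing x lam (M + n)%N <= s ^+ 2 ->
    `|lam (M + n)%N| <= K * s.
Proof.
have /choice[K hK] : forall k, exists K : R, 0 <= K /\
  forall M N x u lam s, homogeneous_solution M N x u lam ->
    0 <= s -> pairing x lam M - pairing x lam N <= s ^+ 2 ->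
    forall m, (M + k < m <= N)%N ->
      `|((A ^+ k *m b)^T *m lam m) ord0 ord0| <= K * s.
  by move=> k; have [K ? ?] := observed_costate k; exists K.
pose C := controllability_mx A b.
have CU : C^T \in unitmx by rewrite unitmx_tr -row_free_unit.
have K0 k : 0 <= K k by have [] := hK k.
have KS : 0 <= \sum_(k < n) K k by apply: sumr_ge0.
exists (n%:R * `|invmx C^T| * \sum_(k < n) K k); first by rewrite !mulr_ge0.
move=> M x u lam s h s0 hs; set l := lam _.
have -> : l = invmx C^T *m (C^T *m l) by rewrite mulmxA mulVmx// mul1mx.
rewrite (le_trans (norm_mulmx _ _))// -[leRHS]mulrA ler_wpM2l ?mulr_ge0//.
apply: norm_mx_le => [|k j]; first by rewrite mulr_ge0.
have -> : (C^T *m l) k j = ((A ^+ k *m b)^T *m l) ord0 ord0.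
  by rewrite (ord1 j) !mxE; apply: eq_bigr => i _; rewrite !mxE.
have [_ /(_ _ _ _ _ _ _ h s0 hs (M + n)%N)] := hK k.
move=> /(_ _)/le_trans; apply; first by have := ltn_ord k; lia.
by rewrite ler_wpM2r// (bigD1 k)//= lerDl sumr_ge0.
Qed.

Lemma window_bound : exists2 K : R, 0 <= K &
  forall M x u lam, homogeneous_solution M (M + n)%N x u lam ->
    forall j, (M <= j <= M + n)%N ->
    `|col_mx (x j) (lam j)| ^+ 2 <=
    K * (pairing x lam M - pairing x lam (M + n)%N).
Proof.
have [K K0 hK] := backward_bound; have [K' K'0 hK'] := terminal_costate_bound.
exists ((K * (K' + 1)) ^+ 2); first exact: sqr_ge0.
move=> M x u lam h j jM.
pose s := Num.sqrt (pairing x lam M - pairing x lam (M + n)%N).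
have s0 : 0 <= s := sqrtr_ge0 _.
have s2 : s ^+ 2 = pairing x lam M - pairing x lam (M + n)%N.
  by rewrite sqr_sqrtr// subr_ge0 (pairing_anti h)//; lia.
rewrite -s2 -exprMn ler_sqr ?nnegrE ?mulr_ge0 ?addr_ge0//.
rewrite (le_trans (hK _ _ _ _ _ s h _ s0 _ j jM)) ?s2//; first by lia.
rewrite -mulrA ler_wpM2l// mulrDl mul1r lerD2r.
by apply: hK' h s0 _; rewrite s2.
Qed.

End Trajectories.

(** * Decay of homogeneous solutions *)

Lemma posPart_contract (R : realType) (K v w : R) : 0 <= K -> v <= K * (w - v) ->
  Num.max v 0 <= K / (1 + K) * Num.max w 0.
Proof.
move=> K0 h; have K1 : 0 < 1 + K by rewrite ltr_pwDl.
rewrite -(ler_pM2l K1) mulrA mulrCA divff ?gt_eqF// mulr1.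
have w0 : 0 <= Num.max w 0 by rewrite le_max lexx orbT.
have [v0|v0] := leP v 0; first by rewrite mulr0 mulr_ge0.
have : K * w <= K * Num.max w 0 by rewrite ler_wpM2l// le_max lexx.
lra.
Qed.

(** Here a and d stand for the norms of the boundary data x_M and lam_N, L and Y
    for those of the unknown end values lam_M and x_N, and de for the decay over
    the whole horizon.  Exchanging (a, L) with (d, Y) gives the bound of d Y. *)
Lemma boundary_products (R : realType) (K a d L Y de : R) :
  0 <= K -> 0 <= a -> 0 <= d -> 0 <= L -> 0 <= Y -> 0 <= de <= 1 ->
  L ^+ 2 <= K * (a * L + de * (d * Y)) ->
  Y ^+ 2 <= K * (d * Y + de * (a * L)) ->
  a * L <= (1 + 4 * K ^+ 2) * (a ^+ 2 + de * d ^+ 2).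
Proof.
move=> K0 a0 d0 L0 Y0 /andP[de0 de1] hL hY.
(* In L^2 + de Y^2 both cross terms are absorbed by completing squares. *)
have h1 : de * Y ^+ 2 <= K * (a * L + de * (d * Y)).
  apply: (le_trans (ler_wpM2l de0 hY)).
  rewrite mulrCA ler_wpM2l// mulrDr [leLHS]addrC lerD2r.
  have aL0 : 0 <= a * L by rewrite mulr_ge0.
  by rewrite (le_trans (ler_piMl _ de1)) ?(le_trans (ler_piMl _ de1)) ?mulr_ge0.
have sL : 0 <= (L - 2 * K * a) ^+ 2 := sqr_ge0 _.
have sY : 0 <= de * (Y - 2 * K * d) ^+ 2 by rewrite mulr_ge0 ?sqr_ge0.
have sLa := sqr_ge0 (L - a).
have sa : 0 <= a ^+ 2 := sqr_ge0 a.
have sKa : 0 <= K ^+ 2 * a ^+ 2 by rewrite mulr_ge0 ?sqr_ge0.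
have sKd : 0 <= K ^+ 2 * (de * d ^+ 2) by rewrite !mulr_ge0 ?sqr_ge0.
have sd : 0 <= de * d ^+ 2 by rewrite mulr_ge0 ?sqr_ge0.
have sYd : 0 <= de * Y ^+ 2 by rewrite mulr_ge0 ?sqr_ge0.
have h2 : L ^+ 2 <= 4 * K ^+ 2 * (a ^+ 2 + de * d ^+ 2) by lra.
lra.
Qed.

(** Vp and Vm stand for V_M^+ and V_N^-, and f and g for the decay factors from
    either end.  As f de <= g and g de <= f, a boundary value that leaks across the
    whole horizon is weighted no more than by the factor of its own end. *)
Lemma boundary_superposition (R : realType)
    (K c a d L Y Vp Vm de f g : R) :
  0 <= K -> 0 <= c -> 0 <= a -> 0 <= d -> 0 <= L -> 0 <= Y -> 0 <= de ->
  de <= f -> de <= g -> f <= 1 -> g <= 1 ->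
  Vp <= c * (a * L) -> Vm <= c * (d * Y) ->
  L ^+ 2 <= K * (Vp + de * Vm) -> Y ^+ 2 <= K * (de * Vp + Vm) ->
  K * (f * Vp + g * Vm) <=
  2 * (K * c) * (1 + 4 * (K * c) ^+ 2) * (f * a ^+ 2 + g * d ^+ 2).
Proof.
move=> K0 c0 a0 d0 L0 Y0 de0 def deg f1 g1 Vpa Vmd hL hY.
pose C := 1 + 4 * (K * c) ^+ 2; rewrite -/C.
have C0 : 0 <= C by rewrite addr_ge0// mulr_ge0// sqr_ge0.
have Kc0 : 0 <= K * c by rewrite mulr_ge0.
have f0 : 0 <= f by apply: le_trans def.
have g0 : 0 <= g by apply: le_trans deg.
have fde : f * de <= g by rewrite (le_trans _ deg)// ler_piMl.
have gde : g * de <= f by rewrite (le_trans _ def)// ler_piMl.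
have de01 : 0 <= de <= 1 by rewrite de0 (le_trans def).
have hL' : L ^+ 2 <= K * c * (a * L + de * (d * Y)).
  apply: (le_trans hL); rewrite -mulrA ler_wpM2l// mulrDr lerD//.
  by rewrite mulrCA ler_wpM2l.
have hY' : Y ^+ 2 <= K * c * (d * Y + de * (a * L)).
  apply: (le_trans hY); rewrite -mulrA ler_wpM2l// addrC mulrDr lerD//.
  by rewrite mulrCA ler_wpM2l.
have haL : a * L <= C * (a ^+ 2 + de * d ^+ 2).
  exact: (boundary_products Kc0 a0 d0 L0 Y0 de01 hL' hY').
have hdY : d * Y <= C * (d ^+ 2 + de * a ^+ 2).
  exact: (boundary_products Kc0 d0 a0 Y0 L0 de01 hY' hL').
have e1 : f * Vp <= c * C * (f * a ^+ 2 + g * d ^+ 2).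
  have : f * Vp <= f * (c * (C * (a ^+ 2 + de * d ^+ 2))).
    by rewrite ler_wpM2l// (le_trans Vpa)// ler_wpM2l.
  have : c * C * d ^+ 2 * (f * de) <= c * C * d ^+ 2 * g.
    by rewrite ler_wpM2l// !mulr_ge0.
  lra.
have e2 : g * Vm <= c * C * (f * a ^+ 2 + g * d ^+ 2).
  have : g * Vm <= g * (c * (C * (d ^+ 2 + de * a ^+ 2))).
    by rewrite ler_wpM2l// (le_trans Vmd)// ler_wpM2l.
  have : c * C * a ^+ 2 * (g * de) <= c * C * a ^+ 2 * f.
    by rewrite ler_wpM2l// !mulr_ge0.
  lra.
apply: (le_trans (ler_wpM2l K0 (lerD e1 e2))); lra.
Qed.

Section Decay.
Variables (R : realType) (n : nat) (A : 'M[R]_n) (b : 'cV[R]_n)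
  (Q : 'M[R]_n) (r : R).
Hypotheses (hQ : posdefmx Q) (hr : 0 < r) (hn : (0 < n)%N)
  (hAb : controllable A b).

Let hom := @homogeneous_solution R n A b Q r.

Lemma norm_pairing_col x lam i :
  `|@pairing R n x lam i| <= n%:R * `|col_mx (x i) (lam i)| ^+ 2.
Proof.
apply: le_trans (norm_pairing _ _ _) _.
by rewrite norm_col_mx expr2 mulrA ler_pM ?mulr_ge0// ?ler_wpM2l// le_max lexx ?orbT.
Qed.

(** V^+ and V^- satisfy the same contraction, V^+ in forward and V^- in reversed
    time, because both ends of a window are bounded by the decrease of V over it. *)
Lemma long_horizon_bound : exists K sg : R, [/\ 0 <= K, 0 <= sg < 1 &
  forall M N x u lam, hom M N x u lam -> (M + n <= N)%N ->
    forall i, (M <= i <= N)%N ->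
    `|col_mx (x i) (lam i)| ^+ 2 <=
    K * (sg ^+ ((i - M) %/ n).-1 * Num.max (pairing x lam M) 0 +
         sg ^+ ((N - i) %/ n).-1 * Num.max (- pairing x lam N) 0)].
Proof.
have [K K0 hK] := window_bound hQ hr hn hAb.
pose L := n%:R * K; have L0 : 0 <= L by rewrite mulr_ge0.
have L1 : 0 < 1 + L by rewrite ltr_pwDl.
pose sg := L / (1 + L).
have sg0 : 0 <= sg by rewrite divr_ge0// ltW.
exists K, sg; split=> //; first by rewrite sg0/= ltr_pdivrMr// mul1r ltrDr.
move=> M N x u lam h MN i iMN; set V := pairing x lam.
have anti j k : (M <= j <= k)%N -> (k <= N)%N -> V k <= V j.
  by apply: (pairing_anti hQ hr h).
have window j k : (M <= j <= k)%N -> (k <= j + n)%N -> (j + n <= N)%N ->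
    `|col_mx (x k) (lam k)| ^+ 2 <= K * (V j - V (j + n)%N).
  move=> Mjk kj jN; apply: (hK j x u lam); last by lia.
  by apply: homogeneous_solution_sub h; lia.
have small j k : (M <= j <= k)%N -> (k <= j + n)%N -> (j + n <= N)%N ->
    `|V k| <= L * (V j - V (j + n)%N).
  move=> Mjk kj jN; apply: le_trans (norm_pairing_col _ _ _) _.
  by rewrite /L -mulrA ler_wpM2l// window.
have fwd k : (k <= N - M)%N -> Num.max (V (M + (k - n))%N) 0 <=
    sg ^+ (k %/ n).-1 * Num.max (V M) 0.
  move=> kN; rewrite -[M in leRHS]addn0.
  apply: (@geometric_decay R n (fun k => Num.max (V (M + k)%N) 0) sg (N - M)%N) => //.
    by move=> j l jl; rewrite ge_max !le_max lexx orbT andbT anti//; lia.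
  move=> j jN; apply: posPart_contract => //.
  rewrite addnA (le_trans (ler_norm _))// small//; lia.
have bwd k : (k <= N - M)%N -> Num.max (- V (N - (k - n))%N) 0 <=
    sg ^+ (k %/ n).-1 * Num.max (- V N) 0.
  move=> kN; rewrite -[N in leRHS]subn0.
  apply: (@geometric_decay R n (fun k => Num.max (- V (N - k)%N) 0) sg (N - M)%N) => //.
    by move=> j l jl; rewrite ge_max !le_max lexx orbT andbT lerN2 anti//; lia.
  move=> j jN; apply: posPart_contract => //.
  have e : (N - j = N - (j + n) + n)%N by lia.
  rewrite (le_trans (ler_norm _))// normrN opprK [- _ + _]addrC e small//; lia.
(* A window of n stages that contains i and lies within [i - n, i + n] and
   within [M, N]. *)
pose j := minn i (N - n).
have zi : `|col_mx (x i) (lam i)| ^+ 2 <= K * (V j - V (j + n)%N).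
  by apply: window; rewrite /j; lia.
apply: (le_trans zi); rewrite ler_wpM2l// lerD//.
  apply: le_trans (fwd (i - M)%N ltac:(lia)); rewrite le_max anti//; rewrite /j; lia.
apply: le_trans (bwd (N - i)%N ltac:(lia)).
by rewrite le_max lerN2 anti//; rewrite /j; lia.
Qed.

Lemma homogeneous_decay : exists K sg : R, [/\ 0 <= K, 0 <= sg < 1 &
  forall M N x u lam, hom M N x u lam -> (M < N)%N ->
    forall i, (M <= i <= N)%N ->
    `|col_mx (x i) (lam i)| ^+ 2 <=
    K * sg ^+ ((i - M) %/ n).-1 * `|x M| ^+ 2 +
    K * sg ^+ ((N - i) %/ n).-1 * `|lam N| ^+ 2].
Proof.
have [Ks Ks0 hs] := short_horizon_bound A b hQ hr.
have [Kl [sg [Kl0 sg01 hl]]] := long_horizon_bound.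
have /andP[sg0 sg1] := sg01.
pose eta k := sg ^+ (k %/ n).-1.
have eta0 k : 0 <= eta k by rewrite exprn_ge0.
have eta1 k : eta k <= 1 by rewrite exprn_ile1// ltW.
have eta_anti j k : (j <= k)%N -> eta k <= eta j.
  move=> jk; have := leq_div2r n jk => jk'.
  by rewrite ler_wiXn2l ?(ltW sg1)//; lia.
have eta_small k : (k < n)%N -> eta k = 1.
  by move=> kn; rewrite /eta divn_small// expr0.
pose C := 2 * (Kl * n%:R) * (1 + 4 * (Kl * n%:R) ^+ 2).
have C0 : 0 <= C by rewrite !mulr_ge0// addr_ge0// mulr_ge0// sqr_ge0.
exists (Ks + C), sg; split=> //; first by rewrite addr_ge0.
move=> M N x u lam h MN i iMN; rewrite -/(eta (i - M)%N) -/(eta (N - i)%N).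
rewrite -[_ * _ * `|x M| ^+ 2]mulrA -[_ * _ * `|lam N| ^+ 2]mulrA -mulrDr mulrDl.
have rhs0 : 0 <= eta (i - M)%N * `|x M| ^+ 2 + eta (N - i)%N * `|lam N| ^+ 2.
  by rewrite addr_ge0// mulr_ge0// sqr_ge0.
(* On a horizon shorter than n both factors eta are 1. *)
have [NM|NM] := ltnP N (M + n).
  have fi : eta (i - M)%N = 1 by apply: eta_small; lia.
  have gi : eta (N - i)%N = 1 by apply: eta_small; lia.
  apply: (le_trans (hs _ _ _ _ _ h ltac:(lia) i iMN)).
  by rewrite fi gi !mul1r in rhs0 *; rewrite lerDl mulr_ge0.
have {}hl := hl _ _ _ _ _ h NM.
have hM := hl M ltac:(lia); have hN := hl N ltac:(lia); have hi := hl i iMN.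
have /andP[Mi iN] := iMN.
have def : eta (N - M)%N <= eta (i - M)%N by apply/eta_anti/leq_sub2r.
have deg : eta (N - M)%N <= eta (N - i)%N by apply/eta_anti/leq_sub2l.
rewrite subnn div0n expr0 mul1r in hM; rewrite subnn div0n expr0 mul1r in hN.
apply: (le_trans hi); rewrite -[leLHS]add0r lerD ?mulr_ge0// /C.
apply: (boundary_superposition (c := n%:R)
  (L := `|lam M|) (Y := `|x N|)) def deg (eta1 _) (eta1 _) _ _ _ _ => //.
- rewrite ge_max; apply/andP; split; last by rewrite !mulr_ge0.
  apply: le_trans (ler_norm _) (le_trans (norm_pairing _ _ _) _).
  by rewrite -mulrA [_ * `|x M|]mulrC.
- rewrite ge_max; apply/andP; split; last by rewrite !mulr_ge0.
  apply: le_trans (ler_norm _) _; rewrite normrN.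
  by apply: le_trans (norm_pairing _ _ _) _; rewrite -mulrA.
- by apply: le_trans hM; rewrite ler_sqr ?nnegrE// norm_col_mx le_max lexx orbT.
- by apply: le_trans hN; rewrite ler_sqr ?nnegrE// norm_col_mx le_max lexx.
Qed.

End Decay.

Theorem theorem2 (R : realType) (n : nat)
    (A : 'M[R]_n) (b c : 'cV[R]_n) (Q : 'M[R]_n) (q : 'cV[R]_n) (r : R)
    (hn : (0 < n)%N) (hQ : posdefmx Q) (hr : 0 < r)
    (hAb : controllable A b) :
  asymptotic_decay_of_sensitivity A b c Q q r
    [set: 'cV[R]_n] [set: 'cV[R]_n].
Proof.
have [K [sg [K0 sg01 hK]]] := homogeneous_decay hQ hr hn hAb.
exists (fun k => Num.sqrt (K * sg ^+ (k %/ n).-1)); split.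
  exact: decay_profile_cvg0.
move=> M N _ MN xM lN xM' lN' _ _ _ _ x u lam x' u' lam' h h' i iMN.
have := hK _ _ _ _ _ (solution_difference h h') MN i iMN.
have [xME lNE _] := h; have [xME' lNE' _] := h'.
rewrite xME lNE xME' lNE' -add_col_mx -opp_col_mx.
have [sg0 _] := andP sg01.
have g0 k : 0 <= K * sg ^+ (k %/ n).-1 by rewrite mulr_ge0 ?exprn_ge0.
rewrite -{1}(sqr_sqrtr (g0 (i - M)%N)) -{1}(sqr_sqrtr (g0 (N - i)%N)).
have s1 := sqrtr_ge0 (K * sg ^+ ((i - M) %/ n).-1).
have s2 := sqrtr_ge0 (K * sg ^+ ((N - i) %/ n).-1).
set a := `|xM - xM'|; set d := `|lN - lN'|.
set e := Num.sqrt _; set e' := Num.sqrt _.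
move=> hz; have a0 : 0 <= a := normr_ge0 _; have d0 : 0 <= d := normr_ge0 _.
rewrite -ler_sqr ?nnegrE ?addr_ge0 ?mulr_ge0//; apply: (le_trans hz).
(* sqrt (e^2 a^2 + e'^2 d^2) <= e a + e' d: the cross term is nonnegative. *)
have : 0 <= e * a * (e' * d) by rewrite !mulr_ge0.
lra.
Qed.
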